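(* Let $\sigma_0\in(0,2)$ and let $l_0:(0,+\infty)\to(0,+\infty)$ be a measurable function, locally bounded away from $0$ and $+\infty$, slowly varying at zero and at infinity, with $l_0(1)=1$. For $\sigma\in[\sigma_0,2)$ let $l_\sigma(r):=r^{-\sigma}l_0(r)^{2-\sigma}$ for $r>0$. Then there exist constants $a_0\ge1$, $a_\infty\ge1$ and $\rho\in(0,1)$, depending only on $\sigma_0$ and $l_0$, such that for every $\sigma\in[\sigma_0,2)$ the function $l_\sigma$ satisfies Property (A) of the context with constants $\sigma,a_0,\rho$ and Property (B) of the context with constants $\sigma,a_\infty$.
   Context: ''Locally bounded away from $0$ and $+\infty$'' means bounded above and below by positive constants on each compact subset of the domain. $l_0$ is slowly varying at zero (at infinity) if for every $\kappa>0$, $l_0(\kappa r)/l_0(r)\to1$ as $r\to0+$ (as $r\to+\infty$). Property (A) for $l$ with constants $\sigma\in(0,2)$, $a_0\ge1$, $\rho\in(0,1)$: (a) there is $\delta\in[0,\frac12\min(2-\sigma,\sigma))$ with $\frac{l(s)}{l(r)}\le a_0\max\{(s/r)^{-\sigma+\delta},(s/r)^{-\sigma-\delta}\}$ for all $r,s\in(0,1]$; (b) with $L(r):=\sigma\int_r^1\frac{l(s)}{s}ds$, one has $\frac12\le\frac{L(r)}{l(r)}\le 2$ for all $r\in(0,\rho)$; (c) $l(1)=1$. Property (B) for $l$ with constants $\sigma$ and $a_\infty\ge1$: there is $\delta'\in[0,\frac12\min(2-\sigma,\sigma))$ with $\frac{l(s)}{l(r)}\le a_\infty\max\{(s/r)^{-\sigma+\delta'},(s/r)^{-\sigma-\delta'}\}$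 for all $r,s\in[1,+\infty)$. *)

(* Defs.v *)
From mathcomp Require Import all_boot all_order all_algebra.
From mathcomp Require Import all_classical all_reals all_analysis.
Set Implicit Arguments.
Unset Strict Implicit.
Unset Printing Implicit Defensive.
Import Order.TTheory GRing.Theory Num.Theory.
Import numFieldNormedType.Exports.
Local Open Scope classical_set_scope.
Local Open Scope ring_scope.

(* Functions on (0, +oo) are total functions R -> R whose values outside
   (0, +oo) are never used. *)

Definition locally_bounded_away (R : realType) (f : R -> R) : Prop :=
  forall K : set R, compact K -> K `<=` `]0, +oo[ ->
    exists c C : R, [/\ 0 < c, 0 < C & forall x, K x -> c <= f x <= C].

Definition slowly_varying_at_zero (R : realType) (f : R -> R) : Prop :=
  forall k : R, 0 < k -> f (k * r) / f r @[r --> 0^'+] --> (1 : R).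

Definition slowly_varying_at_infinity (R : realType) (f : R -> R) : Prop :=
  forall k : R, 0 < k -> f (k * r) / f r @[r --> +oo] --> (1 : R).

(* The slack exponent delta may depend on sigma and on l; the constant a is a
   parameter. *)
Definition scaling_on (R : realType) (D : set R) (l : R -> R) (sigma a : R)
    : Prop :=
  exists delta : R,
    0 <= delta < 2^-1 * Num.min (2 - sigma) sigma /\
    forall r s : R, D r -> D s ->
      l s / l r <= a * Num.max ((s / r) `^ (- sigma + delta))
                               ((s / r) `^ (- sigma - delta)).

(* For positive measurable l, the real-valued integral is 0 when the integral
   diverges, in which case the lower bound in property_A fails. *)
Definition big_L (R : realType) (l : R -> R) (sigma r : R) : R :=
  sigma * \int[lebesgue_measure]_(s in `[r, 1]) (l s / s).

Definition property_A (R : realType) (l : R -> R) (sigma a0 rho : R) : Prop :=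
  [/\ scaling_on `]0, 1] l sigma a0,
      forall r : R, 0 < r < rho -> 2^-1 <= big_L l sigma r / l r <= 2
    & l 1 = 1].

Definition property_B (R : realType) (l : R -> R) (sigma ainf : R) : Prop :=
  scaling_on `[1, +oo[ l sigma ainf.

Definition l_sigma (R : realType) (l0 : R -> R) (sigma r : R) : R :=
  r `^ (- sigma) * l0 r `^ (2 - sigma).

(* Main.v *)
Require Import Defs.
From mathcomp Require Import all_boot all_order all_algebra.
From mathcomp Require Import all_classical all_reals all_analysis.
From mathcomp Require Import measurable_realfun lra ring.
Set Implicit Arguments.
Unset Strict Implicit.
Unset Printing Implicit Defensive.
Import Order.TTheory GRing.Theory Num.Theory.
Import numFieldNormedType.Exports.
Local Open Scope classical_set_scope.
Local Open Scope ring_scope.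

(** The exponential substitution r = exp (- x) at zero, r = exp x at infinity,
turns slow variation of [l0] into a statement about the logarithmic profile
h x = ln (l0 (exp (c * x))) with c = -1 or 1: for every fixed t the increment
h (x + t) - h x tends to 0 as x tends to +oo.  Since h is measurable, this
convergence is uniform for t in [0, 1] ([translation_uniform_convergence], the
uniform convergence theorem of Karamata's theory).  Chaining unit steps then
shows that h has arbitrarily small slope far out, and local boundedness takes
care of the compact part that remains ([log_profile_slope_bounds]).  This gives
two estimates of Potter type, for every e > 0:
- for x, y >= 0 arbitrary, |h y - h x| <= C + e * |y - x|;
- for x large and y >= 0 arbitrary, |h y - h x| <= e * (1 + |y - x|).

The exponent 2 - sigma of [l0] in [l_sigma] is at most 2.  So the first estimate
compares [l_sigma] with the power r^(- sigma) up to the factor exp (2 C) and a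
change of exponent by delta = (2 - sigma) e.  With e = sigma0 / 16 this delta is
below half of min (2 - sigma, sigma), whatever sigma >= sigma0
([scaling_on_l_sigma]).

The second estimate has no large constant: for r small and all s in [r, 1], the
ratio l_sigma(s) / l_sigma(r) lies between exp (- 2 e) (s/r)^(- sigma - 2 e) and
exp (2 e) (s/r)^(- sigma + 2 e).  Integrating these powers against ds / s shows
that L(r) / l_sigma(r) lies between
exp (- 2 e) sigma / (sigma + 2 e) (1 - r^(sigma + 2 e)) and
exp (2 e) sigma / (sigma - 2 e), which are within [1/2, 2] uniformly in sigma
once r^sigma0 <= 1/4 ([big_L_l_sigma_bounds]). *)

(** * Uniform convergence of increments *)

Lemma lebesgue_measure_preimage_shift (R : realType) (t : R) (A : set R) :
  measurable A -> lebesgue_measure ((fun x => x - t) @^-1` A) = lebesgue_measure A.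
Proof.
move=> mA.
have mt : measurable_fun [set: R] (fun x : R => x - t).
  exact: measurable_funB.
pose nu := pushforward lebesgue_measure (fun x : R => x - t : measurableTypeR R).
have : lebesgue_measure A = nu A.
  apply: lebesgue_measure_unique mA => //= _ [[a b]] _ <-.
  rewrite /nu /pushforward/=.
  have -> : (fun x : R => x - t) @^-1` `]a, b] = `]a + t, b + t]%classic.
    by apply/seteqP; split=> x /=; rewrite !in_itv/= ltrBrDr lerBlDr.
  rewrite !lebesgue_measure_itv/= !lte_fin ltrD2r; case: ifP => // _.
  by rewrite -!EFinB; congr EFin; ring.
by [].
Qed.

(** If uniformity failed along points x n and steps t n, Egorov's theorem on
[0, 2] applied to the increments from x n, and to those from x n + t n, would
make both small, for n large, off sets B and B' of measure less than 1/4.  A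
point s of [1, 2] with s outside B and s - t n outside B' would give a common
intermediate value h (x n + s), close to both h (x n) and h (x n + t n).  Hence
[1, 2] is covered by B and a translate of B', whose total measure is less than
1/2. *)
Lemma translation_uniform_convergence (R : realType) (h : R -> R) :
  measurable_fun [set: R] h ->
  (forall t : R, h (x + t) - h x @[x --> +oo] --> (0 : R)) ->
  forall e : R, 0 < e -> exists X : R, forall x t : R,
    X <= x -> 0 <= t <= 1 -> `|h (x + t) - h x| <= e.
Proof.
move=> mh ch e e0; apply: contrapT => /forallNP bad.
have /choice[xt bad_xt] : forall n : nat, exists p : R * R,
    [/\ n%:R <= p.1, 0 <= p.2 <= 1 & e < `|h (p.1 + p.2) - h p.1|].
  move=> n; have /existsNP[x /existsNP[t /not_implyP[nx /not_implyP[t01 hxt]]]] :=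
    bad n%:R.
  by exists (x, t); split=> //; rewrite ltNge; apply/negP.
(* Both sequences of base points, x n and x n + t n, go through the same
   application of Egorov's theorem. *)
have almost (y : nat -> R) : (forall n, n%:R <= y n) ->
    exists B : set R, [/\ measurable B, (lebesgue_measure B < (4^-1)%:E)%E &
      \forall n \near \oo, forall t, 0 <= t <= 2 -> ~ B t ->
        `|h (y n + t) - h (y n)| < e / 2].
  move=> yn.
  have yoo : y n @[n --> \oo] --> +oo.
    apply/cvgryPge => A; near=> n; apply: le_trans (yn n).
    by near: n; exact: nbhs_infty_ger.
  have [|||||B [mB muB unif]] := @pointwise_almost_uniform _ R (measurableTypeR R)
      lebesgue_measure (fun n t => h (y n + t) - h (y n)) (cst 0) `[0, 2] 4^-1.
  - move=> n; apply: measurable_funTS; apply: measurable_funB => //.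
    by apply: measurableT_comp => //; exact: measurable_funD.
  - exact: measurable_itv.
  - exact/compact_finite_measure/segment_compact.
  - move=> t _; exact: (cvg_comp _ _ yoo (ch t)).
  - by rewrite invr_gt0.
  exists B; split=> //.
  have : nbhs (cst 0 : {uniform` `[0, 2] `\` B -> R})
      [set u | forall t, (`[0, 2] `\` B) t -> ball (0 : R) (e / 2) (u t)].
    apply/uniform_nbhs; exists [set p | ball p.1 (e / 2) p.2].
    by split=> //; apply: (entourage_ball _ (PosNum (divr_gt0 e0 (ltr0n _ 2)))).
  move=> /unif near_un; near=> n => t t02 nBt.
  have un : forall t, (`[0, 2] `\` B) t ->
      ball (0 : R) (e / 2) (h (y n + t) - h (y n)).
    by near: n.
  have /un : (`[0, 2] `\` B) t by split=> //=; rewrite in_itv.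
  by rewrite /ball/= sub0r normrN.
have [B [mB muB Bn]] := almost (fun n => (xt n).1)
  (fun n => let: And3 a _ _ := bad_xt n in a).
have [B' [mB' muB' Bn']] : exists B : set R,
    [/\ measurable B, (lebesgue_measure B < (4^-1)%:E)%E &
      \forall n \near \oo, forall t, 0 <= t <= 2 -> ~ B t ->
        `|h ((xt n).1 + (xt n).2 + t) - h ((xt n).1 + (xt n).2)| < e / 2].
  apply: (almost (fun n => (xt n).1 + (xt n).2)) => n.
  by have [a /andP[b _] _] := bad_xt n; lra.
have [n [/= nB nB']] := filter_ex (filterI Bn Bn').
have [_ /andP[t0 t1] big] := bad_xt n.
set x := (xt n).1 in nB nB' big; set t := (xt n).2 in nB nB' big t0 t1.
have cover : `[1, 2]%classic `<=` B `|` (fun s : R => s - t) @^-1` B'.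
  move=> s /=; rewrite in_itv/= => /andP[s1 s2]; apply: contrapT.
  move=> /not_orP[Bs /= B's].
  have s02 : 0 <= s <= 2 by apply/andP; split; lra.
  have st02 : 0 <= s - t <= 2 by apply/andP; split; lra.
  have := nB s s02 Bs; have := nB' _ st02 B's.
  have -> : x + t + (s - t) = x + s by ring.
  move: big; rewrite !ltr_norml lter_normr => /orP[] ? /andP[? ?] /andP[? ?]; lra.
have mB't : measurable ((fun s : R => s - t) @^-1` B').
  rewrite -[X in measurable X]setTI.
  have mt : measurable_fun [set: R] (fun x : R => x - t) by exact: measurable_funB.
  exact: mt.
have : (lebesgue_measure `[1%R : R, 2%R] <= (2^-1)%:E)%E.
  apply: (@le_trans _ _ (lebesgue_measure (B `|` (fun s : R => s - t) @^-1` B'))).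
    by apply: le_measure; rewrite ?inE//; exact: measurableU.
  have := measureU2 (@lebesgue_measure R) mB mB't; move/le_trans; apply.
  have muB't : (lebesgue_measure ((fun s : R => (s - t)%R) @^-1` B') <= 4^-1%:E)%E.
    by rewrite lebesgue_measure_preimage_shift// ltW.
  apply: le_trans (leeD (ltW muB) muB't) _.
  by rewrite -EFinD lee_fin; lra.
rewrite lebesgue_measure_itv/= lte_fin ltr1n/= -EFinB lee_fin; lra.
Unshelve. all: by end_near.
Qed.

(** * Slope of a function with vanishing increments *)

(** Going from x to y takes at most 1 + |y - x| steps of length at most 1, each
of which changes h by at most e. *)
Lemma slope_bound_of_uniform_increments (R : realType) (h : R -> R) (X e : R) :
  (forall x t : R, X <= x -> 0 <= t <= 1 -> `|h (x + t) - h x| <= e) ->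
  forall x y : R, X <= x -> X <= y -> `|h y - h x| <= e * (1 + `|y - x|).
Proof.
move=> hX.
have e0 : 0 <= e by apply: le_trans (hX X 0 _ _); rewrite ?lexx ?ler01.
have walk (n : nat) x t : X <= x -> 0 <= t <= 1 ->
    `|h (x + n%:R + t) - h x| <= e * n.+1%:R.
  elim: n x => [|n IH] x Xx t01; first by rewrite addr0 mulr1; exact: hX.
  have -> : x + n.+1%:R + t = x + 1 + n%:R + t by rewrite -natr1; ring.
  rewrite -(subrK (h (x + 1)) (h _)) -addrA (le_trans (ler_normD _ _))//.
  rewrite -[n.+2%:R]natr1 mulrDr mulr1 lerD//.
    by apply: IH => //; lra.
  by apply: hX => //; rewrite ler01 lexx.
have ordered x y : X <= x -> x <= y -> `|h y - h x| <= e * (1 + (y - x)).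
  move=> Xx xy; set n := Num.truncn (y - x).
  have /andP[ny yn] : n%:R <= y - x < n.+1%:R by apply: truncn_itv; lra.
  have -> : y = x + n%:R + (y - x - n%:R) by ring.
  apply: (le_trans (walk _ _ _ Xx _)).
    by move: yn; rewrite -natr1; lra.
  by apply: ler_wpM2l => //; rewrite -natr1; lra.
move=> x y Xx Xy; have [xy|/ltW yx] := leP x y.
  by rewrite (ger0_norm (_ : 0 <= y - x)) ?subr_ge0//; exact: ordered.
rewrite distrC (distrC y) (ger0_norm (_ : 0 <= x - y)) ?subr_ge0//.
exact: ordered.
Qed.

(** Only [x] has to be far out.  When [y] falls in the bounded part, the
oscillation of [h] there is a constant, and the distance from [x] to that part
is large enough to absorb it into the slope. *)
Lemma far_slope_bound (R : realType) (h : R -> R) :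
  (forall e : R, 0 < e -> exists X : R, forall x t : R,
     X <= x -> 0 <= t <= 1 -> `|h (x + t) - h x| <= e) ->
  (forall X : R, exists M : R, forall x, 0 <= x <= X -> `|h x| <= M) ->
  forall e : R, 0 < e -> exists X : R, forall x y : R,
    X <= x -> 0 <= y -> `|h y - h x| <= e * (1 + `|y - x|).
Proof.
move=> unif loc e e0.
have e20 : 0 < e / 2 by rewrite divr_gt0.
have [X1 hX1] := unif _ e20.
pose X0 := Num.max 0 X1.
have [M hM] := loc X0.
have X00 : 0 <= X0 by rewrite /X0 le_max lexx.
have M0 : 0 <= M by apply: le_trans (hM 0 _); rewrite ?lexx ?X00.
have X01 : X1 <= X0 by rewrite /X0 le_max lexx orbT.
have slope x y : X0 <= x -> X0 <= y -> `|h y - h x| <= e / 2 * (1 + `|y - x|).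
  move=> xX yX; apply: (slope_bound_of_uniform_increments hX1); lra.
(* Beyond this point 2 M, the oscillation on [0, X0], is at most half of
   e * (x - X0); the other half pays for the slope e / 2 from X0 to x. *)
exists (X0 + 4 * M / e) => x y xX y0.
have Me0 : 0 <= 4 * M / e by rewrite divr_ge0 ?mulr_ge0// ltW.
have xX0 : X0 <= x by lra.
have [yX|/ltW yX] := leP X0 y.
  apply: (le_trans (slope _ _ xX0 yX)); apply: ler_wpM2r; last lra.
  by rewrite addr_ge0.
rewrite -(subrK (h X0) (h y)) -addrA (le_trans (ler_normD _ _))//.
have h1 := slope x X0 xX0 (lexx _).
have h2 : `|h y - h X0| <= M + M.
  by rewrite (le_trans (ler_normB _ _))// lerD// hM ?y0 ?X00 ?lexx.
have h3 : 4 * M <= e * (x - X0).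
  by rewrite [leRHS]mulrC -ler_pdivrMr//; lra.
have h4 : e * (x - X0) <= e * (x - y) by rewrite ler_pM2l//; lra.
have nX : `|X0 - x| = x - X0 by rewrite distrC ger0_norm// subr_ge0.
have ny : `|y - x| = x - y by rewrite distrC ger0_norm// subr_ge0; lra.
rewrite ny; move: h1; rewrite nX !(mulrDr _ 1) !mulr1.
have -> : e / 2 * (x - X0) = e * (x - X0) / 2 by ring.
lra.
Qed.

Lemma global_slope_bound (R : realType) (h : R -> R) (e X : R) : 0 < e ->
  (forall X : R, exists M : R, forall x, 0 <= x <= X -> `|h x| <= M) ->
  (forall x y : R, X <= x -> 0 <= y -> `|h y - h x| <= e * (1 + `|y - x|)) ->
  exists2 C : R, 0 <= C & forall x y : R, 0 <= x -> 0 <= y ->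
    `|h y - h x| <= C + e * `|y - x|.
Proof.
move=> e0 loc hX; have [M hM] := loc (Num.max 0 X).
have M0 : 0 <= M.
  by apply: le_trans (hM 0 _); rewrite ?lexx // le_max lexx.
exists (e + (M + M)); first lra.
move=> x y x0 y0.
have d0 : 0 <= e * `|y - x| by rewrite mulr_ge0// ltW.
have [xX|xX] := leP X x.
  by have := hX x y xX y0; rewrite mulrDr mulr1; lra.
have [yX|yX] := leP X y.
  by have := hX y x yX x0; rewrite distrC (distrC x) (mulrDr e 1) mulr1; lra.
have : `|h y - h x| <= M + M.
  have xm : 0 <= x <= Num.max 0 X by rewrite x0 le_max (ltW xX) orbT.
  have ym : 0 <= y <= Num.max 0 X by rewrite y0 le_max (ltW yX) orbT.
  by rewrite (le_trans (ler_normB _ _))// lerD// hM.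
lra.
Qed.

(** * Logarithmic profile of a slowly varying function *)

(** The sign of [c] selects the end at which [l0] is observed as [x] tends to
+oo: zero for c = -1, infinity for c = 1. *)
Definition log_profile (R : realType) (l0 : R -> R) (c x : R) : R :=
  ln (l0 (expR (c * x))).

Lemma measurable_log_profile (R : realType) (l0 : R -> R) (c : R) :
  measurable_fun (`]0, +oo[ : set R) l0 ->
  measurable_fun [set: R] (log_profile l0 c).
Proof.
move=> ml0; rewrite /log_profile.
apply: (@measurableT_comp _ _ _ _ _ _ (@ln R)) => //.
apply: (measurable_comp _ _ ml0) => //.
  by move=> _ [x _ <-]; rewrite /= in_itv/= andbT expR_gt0.
exact: (@measurableT_comp _ _ _ _ _ _ (@expR R)).
Qed.

Lemma log_profile_increment_cvg0 (R : realType) (l0 : R -> R) (c : R)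
    (F : set_system R) : Filter F ->
  (forall r : R, 0 < r -> 0 < l0 r) ->
  (forall k : R, 0 < k -> l0 (k * r) / l0 r @[r --> F] --> (1 : R)) ->
  expR (c * x) @[x --> +oo] --> F ->
  forall t : R,
    log_profile l0 c (x + t) - log_profile l0 c x @[x --> +oo] --> (0 : R).
Proof.
move=> FF l0_pos sv toF t.
have -> : (fun x => log_profile l0 c (x + t) - log_profile l0 c x) = (@ln R) \o
    ((fun r => l0 (expR (c * t) * r) / l0 r) \o (fun x => expR (c * x))).
  apply/funext => x /=; rewrite -expRD -mulrDr (addrC t) /log_profile.
  by rewrite ln_div ?posrE ?l0_pos ?expR_gt0.
rewrite -(@ln1 R); apply: continuous_cvg; first exact: continuous_ln.
by apply: cvg_comp toF _; apply: sv; exact: expR_gt0.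
Qed.

Lemma log_profile_locally_bounded (R : realType) (l0 : R -> R) (c : R) :
  (forall r : R, 0 < r -> 0 < l0 r) -> locally_bounded_away l0 ->
  forall X : R, exists M : R, forall x, 0 <= x <= X ->
    `|log_profile l0 c x| <= M.
Proof.
move=> l0_pos loc X.
have [||a [b [a0 b0 ab]]] := loc ((fun x => expR (c * x)) @` `[0, X]).
- apply: continuous_compact; last exact: segment_compact.
  apply: continuous_subspaceT => x.
  apply: continuous_comp; last exact: continuous_expR.
  by apply: cvgM; [exact: cvg_cst|exact: cvg_id].
- by move=> _ [x _ <-]; rewrite /= in_itv/= andbT expR_gt0.
exists (`|ln a| + `|ln b|) => x x0X.
have /andP[al lb] : a <= l0 (expR (c * x)) <= b by apply: ab; exists x.
have p := l0_pos _ (expR_gt0 (c * x)).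
have : ln a <= log_profile l0 c x by rewrite ler_ln ?posrE.
have : log_profile l0 c x <= ln b by rewrite ler_ln ?posrE.
have := ler_norm (ln b); have := lerNnormlW (lexx `|ln a|).
have := normr_ge0 (ln a); have := normr_ge0 (ln b).
by rewrite ler_norml; lra.
Qed.

(** Potter's bounds in logarithmic coordinates: a factor of [l0] is a summand
here and a power is a slope.  The first bound has no large constant and serves
for the integral L; the second one holds up to the endpoint r = 1 (x = 0) in
both variables and serves for the scaling conditions. *)
Lemma log_profile_slope_bounds (R : realType) (l0 : R -> R) (c : R)
    (F : set_system R) : Filter F ->
  (forall r : R, 0 < r -> 0 < l0 r) ->
  measurable_fun (`]0, +oo[ : set R) l0 -> locally_bounded_away l0 ->
  (forall k : R, 0 < k -> l0 (k * r) / l0 r @[r --> F] --> (1 : R)) ->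
  expR (c * x) @[x --> +oo] --> F ->
  let h := log_profile l0 c in
  forall e : R, 0 < e -> exists X C : R, [/\ 0 <= C,
    forall x y : R, X <= x -> 0 <= y -> `|h y - h x| <= e * (1 + `|y - x|) &
    forall x y : R, 0 <= x -> 0 <= y -> `|h y - h x| <= C + e * `|y - x|].
Proof.
move=> FF l0_pos ml0 loc sv toF h e e0.
have hloc := @log_profile_locally_bounded _ _ c l0_pos loc.
have unif := translation_uniform_convergence (measurable_log_profile c ml0)
  (log_profile_increment_cvg0 FF l0_pos sv toF).
have [X hX] := far_slope_bound unif hloc e0.
have [C C0 hC] := global_slope_bound e0 hloc hX.
by exists X, C.
Qed.

Lemma expR_Nid_cvg_at_right0 (R : realType) :
  expR (-1 * x) @[x --> +oo] --> (0 : R)^'+.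
Proof.
move=> P P0; have near0 : \forall x \near +oo, 0 < expR (- x) -> P (expR (- x)).
  exact: (@cvgr_expR R _ P0).
have : \forall x \near +oo, P (expR (-1 * x)).
  by near=> x; rewrite mulN1r; apply: (near near0 x) => //; exact: expR_gt0.
by [].
Unshelve. all: by end_near.
Qed.

Lemma expR_id_cvgy (R : realType) : expR (1 * x) @[x --> +oo] --> pinfty_nbhs R.
Proof.
apply/cvgryPge => A.
apply: filterS (nbhs_pinfty_ge (num_real A)) => x Ax.
by rewrite mul1r; have := expR_ge1Dx x; lra.
Qed.

(** * Integrals of powers *)

Lemma continuous_powR_pos (R : realType) (p s : R) : 0 < s ->
  {for s, continuous (fun x : R => x `^ p)}.
Proof.
move=> s0.
by have [/derivable1_diffP/differentiable_continuous] := is_derive1_powR p s0.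
Qed.

Lemma Rintegral_powR (R : realType) (r g : R) : 0 < r < 1 -> 0 < g ->
  \int[lebesgue_measure]_(s in `[r, 1]) (s `^ (- g - 1)) = (r `^ (- g) - 1) / g.
Proof.
move=> /andP[r0 r1] g0.
have dF (s : R) : 0 < s ->
    is_derive s 1 (fun x => - g^-1 * x `^ (- g)) (s `^ (- g - 1)).
  move=> s0; have -> : s `^ (- g - 1) = - g^-1 * (- g * s `^ (- g - 1)).
    by rewrite mulrA mulrNN mulVf ?gt_eqF// mul1r.
  have := is_derive1_powR (- g) s0; exact: is_deriveZ.
have cF (s : R) : 0 < s -> {for s, continuous (fun x => - g^-1 * x `^ (- g))}.
  by move=> s0; have [/derivable1_diffP/differentiable_continuous] := dF s s0.
rewrite /Rintegral (@continuous_FTC2 _ _ (fun x => - g^-1 * x `^ (- g))) //=.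
- rewrite powR1; field; exact: lt0r_neq0.
- apply: continuous_in_subspaceT => s /[!inE]/=; rewrite in_itv/= => /andP[rs _].
  have s0 : 0 < s by exact: lt_le_trans rs.
  exact: continuous_powR_pos.
- split.
  + by move=> s; rewrite in_itv/= => /andP[rs _]; case: (dF s (lt_trans r0 rs)).
  + exact: cvg_at_right_filter (cF r r0).
  + exact: cvg_at_left_filter (cF 1 ltr01).
- move=> s; rewrite in_itv/= => /andP[rs _].
  by rewrite derive1E; case: (dF s (lt_trans r0 rs)).
Qed.

Lemma integrable_scaled_powR (R : realType) (c r p : R) : 0 < r ->
  lebesgue_measure.-integrable `[r, 1] (EFin \o (fun s : R => c * s `^ p)).
Proof.
move=> r0; apply: continuous_compact_integrable; first exact: segment_compact.
apply: continuous_in_subspaceT => s /[!inE]/=; rewrite in_itv/= => /andP[rs _].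
have s0 : 0 < s by exact: lt_le_trans rs.
by apply: cvgM; [exact: cvg_cst|exact: continuous_powR_pos].
Qed.

Lemma Rintegral_powR_sandwich (R : realType) (f : R -> R) (r c1 c2 g1 g2 : R) :
  0 < r < 1 -> 0 < g1 -> 0 < g2 -> 0 <= c1 ->
  measurable_fun (`[r, 1] : set R) f ->
  (forall s, r <= s <= 1 ->
    c1 * s `^ (- g1 - 1) <= f s <= c2 * s `^ (- g2 - 1)) ->
  c1 * ((r `^ (- g1) - 1) / g1) <= \int[lebesgue_measure]_(s in `[r, 1]) f s
    <= c2 * ((r `^ (- g2) - 1) / g2).
Proof.
move=> r01 g10 g20 c10 mf fb; have /andP[r0 r1] := r01.
have intf : lebesgue_measure.-integrable `[r, 1] (EFin \o f).
  apply: le_integrable (integrable_scaled_powR c2 (- g2 - 1) r0) => //.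
    exact/measurable_EFinP.
  move=> s /=; rewrite in_itv/= => /fb /andP[lo up]; rewrite lee_fin.
  have f0 : 0 <= f s by rewrite (le_trans _ lo)// mulr_ge0// powR_ge0.
  by rewrite !ger0_norm// (le_trans f0).
have ip p : lebesgue_measure.-integrable `[r, 1] (EFin \o (fun s : R => s `^ p)).
  have := integrable_scaled_powR 1 p r0.
  by under [X in EFin \o X]eq_fun do rewrite mul1r.
rewrite -!Rintegral_powR// -!RintegralZl//.
have icp c p := integrable_scaled_powR c p r0.
apply/andP; split; apply: le_Rintegral => // s /=.
  by rewrite in_itv/= => /fb/andP[].
by rewrite in_itv/= => /fb/andP[].
Qed.

(** * The functions l_sigma *)

Lemma l_sigmaE (R : realType) (l0 : R -> R) (sigma r : R) : 0 < r -> 0 < l0 r ->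
  l_sigma l0 sigma r = expR (- sigma * ln r + (2 - sigma) * ln (l0 r)).
Proof. by move=> r0 l0r; rewrite /l_sigma /powR !gt_eqF// expRD. Qed.

(** Raising [l0] to the power 2 - sigma multiplies the slope [e] of its logarithm
by the same factor, so (2 - sigma) * e serves as the slack in the exponent.  The
constant C is multiplied by 2 - sigma <= 2, which keeps exp (2 * C) independent
of sigma. *)
Lemma scaling_on_l_sigma (R : realType) (l0 : R -> R) (D : set R)
    (sigma C e : R) :
  (forall r, D r -> 0 < r /\ 0 < l0 r) ->
  sigma < 2 -> 0 <= C -> 0 <= e ->
  (2 - sigma) * e < 2^-1 * Num.min (2 - sigma) sigma ->
  (forall r s, D r -> D s ->
    `|ln (l0 s) - ln (l0 r)| <= C + e * `|ln s - ln r|) ->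
  scaling_on D (l_sigma l0 sigma) sigma (expR (2 * C)).
Proof.
move=> Dpos sigma2 C0 e0 slack logs; exists ((2 - sigma) * e); split.
  by rewrite slack andbT mulr_ge0// subr_ge0 ltW.
move=> r s Dr Ds; have [r0 l0r] := Dpos r Dr; have [s0 l0s] := Dpos s Ds.
have sr (a : R) : (s / r) `^ a = expR (a * (ln s - ln r)).
  by rewrite /powR gt_eqF ?divr_gt0// ln_div ?posrE.
rewrite !sr !l_sigmaE// -expRB.
have logrs := logs r s Dr Ds.
have sigma20 : 0 <= 2 - sigma by rewrite subr_ge0 ltW.
have sigma0 : 0 < sigma.
  have : 0 < Num.min (2 - sigma) sigma.
    rewrite -(pmulr_rgt0 _ (_ : 0 < 2^-1)) ?invr_gt0//.
    by rewrite (le_lt_trans _ slack)// mulr_ge0.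
  by rewrite lt_min => /andP[].
pose d := ln s - ln r; rewrite -/d in logrs *.
have osc : (2 - sigma) * (ln (l0 s) - ln (l0 r)) <=
    (2 - sigma) * C + (2 - sigma) * e * `|d|.
  rewrite -mulrA -mulrDr ler_wpM2l//; exact: le_trans (ler_norm _) logrs.
have sC : (2 - sigma) * C <= 2 * C.
  by rewrite ler_wpM2r//; lra.
have expE : - sigma * ln s + (2 - sigma) * ln (l0 s) -
    (- sigma * ln r + (2 - sigma) * ln (l0 r)) =
    - sigma * d + (2 - sigma) * (ln (l0 s) - ln (l0 r)) by rewrite /d; ring.
have [d0|d0] := leP 0 d.
  apply: (@le_trans _ _ (expR (2 * C) * expR ((- sigma + (2 - sigma) * e) * d))).
    rewrite -expRD ler_expR expE; move: osc; rewrite ger0_norm// => osc.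
    rewrite [X in _ <= _ + X]mulrDl; lra.
  by rewrite ler_wpM2l ?expR_ge0// le_max lexx.
apply: (@le_trans _ _ (expR (2 * C) * expR ((- sigma - (2 - sigma) * e) * d))).
  rewrite -expRD ler_expR expE; move: osc; rewrite ltr0_norm// mulrN => osc.
  rewrite [X in _ <= _ + X]mulrDl mulNr; lra.
by rewrite ler_wpM2l ?expR_ge0// le_max lexx orbT.
Qed.

Lemma l_sigma_power_envelope (R : realType) (l0 : R -> R) (sigma e r s : R) :
  (forall s : R, 0 < s -> 0 < l0 s) -> 0 <= sigma <= 2 -> 0 <= e -> 0 < r <= s ->
  `|ln (l0 s) - ln (l0 r)| <= e * (1 + (ln s - ln r)) ->
  (expR (2 * e))^-1 * (l_sigma l0 sigma r * r `^ (sigma + 2 * e)) *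
      s `^ (- (sigma + 2 * e) - 1)
    <= l_sigma l0 sigma s / s
    <= expR (2 * e) * (l_sigma l0 sigma r * r `^ (sigma - 2 * e)) *
      s `^ (- (sigma - 2 * e) - 1).
Proof.
move=> l0_pos /andP[sigma_ge0 sigma_le2] e0 /andP[r0 rs] logs.
have s0 : 0 < s by lra.
have d0 : 0 <= ln s - ln r by rewrite subr_ge0 ler_ln.
have sV : s^-1 = expR (- ln s) by rewrite expRN lnK.
have powE (x a : R) : 0 < x -> x `^ a = expR (a * ln x).
  by move=> x0; rewrite /powR gt_eqF.
rewrite !l_sigmaE ?l0_pos// !powE// sV -expRN -!expRD !ler_expR.
move: logs; rewrite ler_norml => /andP[lo up].
set D := ln (l0 s) - ln (l0 r) in lo up.
set b := e * (1 + (ln s - ln r)) in lo up.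
have b0 : 0 <= b by rewrite mulr_ge0//; lra.
have b2 : (2 - sigma) * b <= 2 * b by apply: ler_wpM2r => //; lra.
have ub : (2 - sigma) * D <= 2 * b.
  by apply: le_trans b2; apply: ler_wpM2l => //; lra.
have lb : - (2 * b) <= (2 - sigma) * D.
  rewrite lerNl; apply: le_trans b2; rewrite -mulrN; apply: ler_wpM2l; lra.
by move: ub lb; rewrite /D /b; nra.
Qed.

Lemma measurable_l_sigma_div (R : realType) (l0 : R -> R) (sigma r : R) :
  measurable_fun (`]0, +oo[ : set R) l0 -> 0 < r ->
  measurable_fun (`[r, 1] : set R) (fun s => l_sigma l0 sigma s / s).
Proof.
move=> ml0 r0.
have mS : measurable (`]0, +oo[ : set R) by [].
have sub : `[r, 1]%classic `<=` (`]0, +oo[ : set R).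
  by move=> s /=; rewrite !in_itv/= andbT => /andP[rs _]; lra.
have mf : measurable_fun (`[r, 1] : set R)
    (fun s => s `^ (- sigma) * l0 s `^ (2 - sigma) * s `^ (-1)).
  do 2?apply: measurable_funM; try exact: measurable_funTS.
  apply: (@measurableT_comp _ _ _ _ _ _ (@powR R ^~ (2 - sigma))) => //.
  exact: measurable_funS sub ml0.
apply: eq_measurable_fun mf => s; rewrite inE/= in_itv/= => /andP[rs _].
by rewrite powR_inv1//; lra.
Qed.

(** The constants leave just enough room: with e = sigma0 / 16 < 1/8 the factor
exp (2 * e) is at most 4/3, sigma / (sigma - 2 * e) at most 8/7 and
sigma / (sigma + 2 * e) at least 8/9, so the upper bound is 32/21 <= 2 and the
lower one 3/4 * 8/9 * 3/4 = 1/2. *)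
Lemma big_L_l_sigma_bounds (R : realType) (l0 : R -> R) (sigma0 sigma r : R) :
  (forall s : R, 0 < s -> 0 < l0 s) ->
  measurable_fun (`]0, +oo[ : set R) l0 ->
  0 < sigma0 -> sigma0 <= sigma < 2 -> 0 < r < 1 -> r `^ sigma0 <= 4^-1 ->
  (forall s, r <= s <= 1 ->
    `|ln (l0 s) - ln (l0 r)| <= sigma0 / 16 * (1 + (ln s - ln r))) ->
  2^-1 <= big_L (l_sigma l0 sigma) sigma r / l_sigma l0 sigma r <= 2.
Proof.
move=> l0_pos ml0 s00 /andP[ss sigma2] r01 r4 logs.
have /andP[r0 r1] := r01.
pose e := sigma0 / 16; pose K := expR (2 * e).
have e0 : 0 < e by rewrite divr_gt0.
have eE : sigma0 = 16 * e by rewrite /e; field.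
have e8 : e < 8^-1 by lra.
have K0 : 0 < K by exact: expR_gt0.
have Klo : 3 / 4 <= K^-1.
  by rewrite /K -expRN; apply: le_trans (expR_ge1Dx _); lra.
have Kup : K <= 4 / 3.
  by have := ler_wpM2l (ltW K0) Klo; rewrite mulfV ?gt_eqF//; lra.
have l_pos s : 0 < s -> 0 < l_sigma l0 sigma s.
  by move=> s0; rewrite l_sigmaE ?l0_pos// expR_gt0.
set l := l_sigma l0 sigma in l_pos *.
have g10 : 0 < sigma + 2 * e by lra.
have g20 : 0 < sigma - 2 * e by lra.
have envelope s : r <= s <= 1 ->
    K^-1 * (l r * r `^ (sigma + 2 * e)) * s `^ (- (sigma + 2 * e) - 1) <= l s / s
    <= K * (l r * r `^ (sigma - 2 * e)) * s `^ (- (sigma - 2 * e) - 1).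
  move=> rs1; have /andP[rs s1] := rs1.
  apply: l_sigma_power_envelope => //; last exact: logs.
  - by apply/andP; split; lra.
  - exact: ltW.
  - by rewrite r0.
have mf := measurable_l_sigma_div sigma ml0 r0.
have := Rintegral_powR_sandwich r01 g10 g20 _ mf envelope.
set I := (\int[_]_(_ in _) _).
have factor (k g : R) : sigma * (k * (l r * r `^ g) * ((r `^ (- g) - 1) / g)) =
    k * (sigma / g) * (1 - r `^ g) * l r.
  have <- : r `^ g * (r `^ (- g) - 1) = 1 - r `^ g.
    by rewrite mulrBr mulr1 powRN mulfV// gt_eqF// powR_gt0.
  by ring.
have lr0 := l_pos r r0.
have c10 : 0 <= K^-1 * (l r * r `^ (sigma + 2 * e)).
  by rewrite !mulr_ge0 ?powR_ge0 ?invr_ge0 ?ltW.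
have sigma_gt0 : 0 < sigma by lra.
move=> /(_ c10) /andP[/(ler_wpM2l (ltW sigma_gt0)) lo].
move=> /(ler_wpM2l (ltW sigma_gt0)) up.
rewrite factor in lo; rewrite factor in up.
have sg1 : 8 / 9 <= sigma / (sigma + 2 * e) by rewrite ler_pdivlMr//; lra.
have sg2 : sigma / (sigma - 2 * e) <= 8 / 7 by rewrite ler_pdivrMr//; lra.
have rg1 : 3 / 4 <= 1 - r `^ (sigma + 2 * e).
  have : r `^ (sigma + 2 * e) <= r `^ sigma0.
    by apply: ger_powR; [rewrite r0 ltW|lra].
  lra.
have rg2 : 0 < r `^ (sigma - 2 * e) by exact: powR_gt0.
rewrite /big_L -/I ler_pdivlMr// ler_pdivrMr//; apply/andP; split.
  apply: le_trans lo; rewrite ler_pM2r//.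
  have Ksg1 : 3 / 4 * (8 / 9) <= K^-1 * (sigma / (sigma + 2 * e)).
    by apply: ler_pM => //; lra.
  by apply: le_trans (ler_pM _ _ Ksg1 rg1); lra.
apply: (le_trans up); rewrite ler_pM2r//.
have Ksg2 : K * (sigma / (sigma - 2 * e)) <= 4 / 3 * (8 / 7).
  by apply: ler_pM => //; [exact: ltW|rewrite divr_ge0 ?ltW].
have Ksg2_ge0 : 0 <= K * (sigma / (sigma - 2 * e)).
  by rewrite mulr_ge0 ?divr_ge0 ?ltW.
by have := ler_wpM2l Ksg2_ge0 (_ : 1 - r `^ (sigma - 2 * e) <= 1); lra.
Qed.

Theorem proposition4p1 (R : realType) (sigma0 : R) (l0 : R -> R)
    (sigma0_range : 0 < sigma0 < 2)
    (l0_pos : forall r : R, 0 < r -> 0 < l0 r)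
    (l0_meas : measurable_fun (`]0, +oo[ : set R) l0)
    (l0_loc : locally_bounded_away l0)
    (l0_sv0 : slowly_varying_at_zero l0)
    (l0_svoo : slowly_varying_at_infinity l0)
    (l0_1 : l0 1 = 1) :
  exists a0 ainf rho : R,
    [/\ 1 <= a0, 1 <= ainf, 0 < rho < 1 &
        forall sigma : R, sigma0 <= sigma < 2 ->
          property_A (l_sigma l0 sigma) sigma a0 rho /\
          property_B (l_sigma l0 sigma) sigma ainf].
Proof.
have /andP[s0 s2] := sigma0_range.
pose e := sigma0 / 16.
have e0 : 0 < e by rewrite /e divr_gt0.
have [X [C [C0 hX hC]]] := log_profile_slope_bounds _ l0_pos l0_meas l0_loc
  l0_sv0 (@expR_Nid_cvg_at_right0 R) e0.
have [_ [C' [C'0 _ hC']]] := log_profile_slope_bounds _ l0_pos l0_meas l0_loc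
  l0_svoo (@expR_id_cvgy R) e0.
have Nln (r : R) : 0 < r -> expR (-1 * - ln r) = r.
  by move=> r0; rewrite mulN1r opprK lnK.
have Pln (r : R) : 0 < r -> expR (1 * ln r) = r by move=> r0; rewrite mul1r lnK.
have dist_oppr (a b : R) : `|- b - - a| = `|b - a|.
  by rewrite -opprD normrN.
(* r < rho means that the coordinate x = - ln r of r exceeds X and that
   r^sigma0 <= 1/4; the last bound keeps rho below 1. *)
pose rho := Num.min (expR (- X)) (Num.min (4^-1 `^ sigma0^-1) 2^-1).
have rho0 : 0 < rho by rewrite !lt_min expR_gt0 powR_gt0 ?invr_gt0//=.
exists (expR (2 * C)), (expR (2 * C')), rho; split.
- by rewrite -[leLHS]expR0 ler_expR; lra.
- by rewrite -[leLHS]expR0 ler_expR; lra.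
- by rewrite rho0 !gt_min; apply/orP; right; apply/orP; right; lra.
move=> sigma /andP[ss sigma2].
have slack : (2 - sigma) * e < 2^-1 * Num.min (2 - sigma) sigma.
  have h1 : 0 < (2 - sigma) * (2 - sigma0) by rewrite mulr_gt0 ?subr_gt0.
  have h2 : 0 < sigma * sigma0 by rewrite mulr_gt0//; lra.
  have -> : (2 - sigma) * e = (2 * sigma0 - sigma * sigma0) / 16.
    by rewrite /e; ring.
  have [_|_] := leP (2 - sigma) sigma; lra.
split; last first.
  apply: (scaling_on_l_sigma (e := e)) => //; last first.
  - move=> r s /=; rewrite !in_itv/= !andbT => r1 s1.
    have r0 : 0 < r by lra.
    have s0' : 0 < s by lra.
    have := hC' (ln r) (ln s); rewrite /log_profile !Pln//; apply; exact: ln_ge0.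
  - exact: ltW.
  - by move=> r /=; rewrite in_itv/= andbT => r1; split; [lra|apply: l0_pos; lra].
split.
- apply: (scaling_on_l_sigma (e := e)) => //.
  + by move=> r /=; rewrite in_itv/= => /andP[r0 _]; split=> //; exact: l0_pos.
  + exact: ltW.
  + move=> r s /=; rewrite !in_itv/= => /andP[r0 r1] /andP[s0' s1].
    have := hC (- ln r) (- ln s); rewrite /log_profile !Nln// dist_oppr.
    by apply; rewrite oppr_ge0; exact: ln_le0.
- move=> r /andP[r0]; rewrite !lt_min => /and3P[rX r4 r2].
  have r1 : 0 < r < 1 by rewrite r0; lra.
  apply: (big_L_l_sigma_bounds (sigma0 := sigma0)) => //; first by rewrite ss.
    rewrite (_ : 4^-1 = (4^-1 `^ sigma0^-1) `^ sigma0); last first.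
      by rewrite -powRrM mulVf ?gt_eqF// powRr1// invr_ge0.
    by apply: ge0_ler_powR; rewrite ?nnegrE ?powR_ge0// ltW.
  move=> s /andP[rs s1]; have s0' : 0 < s by lra.
  have lnrs : `|ln s - ln r| = ln s - ln r by rewrite ger0_norm// subr_ge0 ler_ln.
  have := hX (- ln r) (- ln s).
  rewrite /log_profile !Nln// dist_oppr lnrs; apply.
    by rewrite lerNr -[leRHS](expRK) ler_ln ?posrE ?expR_gt0 ?ltW.
  by rewrite oppr_ge0; exact: ln_le0.
- by rewrite /l_sigma powR1 l0_1 powR1 mulr1.
Qed.
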